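(* Let $\mathbf{H}$ be a quantum entropy. Then: 1. $\mathbf{H}(\rho)\ge 0$ for every state $\rho$; 2. $\mathbf{H}(|\psi\rangle\langle\psi|)=0$ for every pure state $|\psi\rangle\langle\psi|$; 3. $\mathbf{H}(\mathbf{u}^{(d)})\ge\mathbf{H}(\sigma)$ for every dimension $d$ and every state $\sigma$ of dimension $d$; 4. $\mathbf{H}(\mathbf{u}^{(2)})>0$.
   Context: All systems (Hilbert spaces) are finite-dimensional (dimension one allowed); $\mathfrak{D}(A)$ is the set of density operators on $A$, $|A|$ its dimension, and $\mathbf{u}^{(d)}=I/d$ the uniform state in dimension $d$. A quantum channel is a completely positive trace-preserving linear map; a channel $\mathcal{N}_A$ from $A$ to $A$ is unital if $\mathcal{N}_A(I_A)=I_A$; an isometric channel is of the form $(\cdot)\mapsto U(\cdot)U^\dagger$ with $U^\dagger U=I$. Majorization: for states $\rho_A$, $\sigma_{A'}$ (possibly of different dimensions), $\rho_A\succ\sigma_{A'}$ if there exist a system $A''$ with $|A''|\ge\max\{|A|,|A'|\}$, isometric channels $\mathcal{V}_{A\to A''}$ and $\mathcal{U}_{A'\to A''}$, and a unital channel $\mathcal{N}_{A''}$ with $\mathcal{U}_{A'\to A''}(\sigma_{A'})=(\mathcal{N}_{A''}\circ\mathcal{V}_{A\to A''})(\rho_A)$. Quantum entropy: a function $\mathbf{H}:\bigcup_A\mathfrak{D}(A)\to\mathbb{R}$, not equal to the zero function, such that for all systems $A,A'$ and states $\rho_A,\sigma_{A'}$: (1) monotonicity: $\rho_A\succ\sigma_{A'}\Rightarrow\mathbf{H}(\rho_A)\le\mathbf{H}(\sigma_{A'})$;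 (2) additivity: $\mathbf{H}(\rho_A\otimes\sigma_{A'})=\mathbf{H}(\rho_A)+\mathbf{H}(\sigma_{A'})$. *)

(* Defs.v *)
From HB Require Import structures.
From mathcomp Require Import all_boot all_order all_algebra.
From mathcomp Require Import reals complex mxtens.

Set Implicit Arguments.
Unset Strict Implicit.
Unset Printing Implicit Defensive.

Import Order.TTheory GRing.Theory Num.Theory.
Local Open Scope ring_scope.
Local Open Scope sesquilinear_scope.

(* A system of dimension n is the Hilbert space C^n of column vectors over
   C = R[i]; operators on it are n x n matrices, M^t* is the adjoint of M, and
   the tensor product is the Kronecker product *t. There is no density operator
   in dimension 0, so every system that carries a state has dimension >= 1. *)

Section Operators.
Variable R : realType.
Local Notation C := R[i].

(* For z : C, 0 <= z means that z is real and nonnegative; over C this makes A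
   Hermitian, so hermiticity is not required separately. *)
Definition psd n (A : 'M[C]_n) : Prop :=
  forall v : 'cV[C]_n, 0 <= (v^t* *m A *m v) 0 0.

Definition density n (rho : 'M[C]_n) : Prop := psd rho /\ \tr rho = 1.

Definition unit_vector n (psi : 'cV[C]_n) : Prop := psi^t* *m psi = 1%:M.

Definition pure_state n (psi : 'cV[C]_n) : 'M[C]_n := psi *m psi^t*.

Definition uniform_state d : 'M[C]_d := (d%:R^-1)%:M.

(* The (i, j) block of an operator on C^k (x) C^m: if X = A *t B, it is
   A i j *: B. *)
Definition tens_block k m (X : 'M[C]_(k * m)) (i j : 'I_k) : 'M[C]_m :=
  \matrix_(a, b) X (mxtens_index (i, a)) (mxtens_index (j, b)).

(* id_k (x) N, obtained by applying N to every block; see id_tensE. *)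
Definition id_tens k m n (N : 'M[C]_m -> 'M[C]_n) (X : 'M[C]_(k * m)) :
    'M[C]_(k * n) :=
  \matrix_(s, t)
    N (tens_block X (mxtens_unindex s).1 (mxtens_unindex t).1)
      (mxtens_unindex s).2 (mxtens_unindex t).2.

Lemma id_tensE k m n (N : 'M[C]_m -> 'M[C]_n) (A : 'M[C]_k) (B : 'M[C]_m) :
  linear N -> id_tens N (A *t B) = A *t N B.
Proof.
move=> linN; have NZ a : N (a *: B) = a *: N B.
  have N0 : N 0 = 0.
    have := linN (-1) 0 0; rewrite scaler0 addr0 => ->.
    by rewrite scaleN1r addNr.
  by have := linN a B 0; rewrite !addr0 N0 addr0.
apply/matrixP => s t; rewrite !mxE.
set i := _.1; set j := _.1.
suff -> : tens_block (A *t B) i j = A i j *: B by rewrite NZ mxE.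
by apply/matrixP => a b; rewrite mxE tensmxE mxE.
Qed.

Definition completely_positive m n (N : 'M[C]_m -> 'M[C]_n) : Prop :=
  forall k (X : 'M[C]_(k * m)), psd X -> psd (id_tens N X).

Definition trace_preserving m n (N : 'M[C]_m -> 'M[C]_n) : Prop :=
  forall X, \tr (N X) = \tr X.

Definition quantum_channel m n (N : 'M[C]_m -> 'M[C]_n) : Prop :=
  [/\ linear N, completely_positive N & trace_preserving N].

Definition unital_channel n (N : 'M[C]_n -> 'M[C]_n) : Prop :=
  quantum_channel N /\ N 1%:M = 1%:M.

Definition isometric_channel m n (V : 'M[C]_m -> 'M[C]_n) : Prop :=
  exists2 U : 'M[C]_(n, m),
    U^t* *m U = 1%:M & forall X, V X = U *m X *m U^t*.

Definition majorizes m n (rho : 'M[C]_m) (sigma : 'M[C]_n) : Prop :=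
  exists k (V : 'M[C]_m -> 'M[C]_k) (U : 'M[C]_n -> 'M[C]_k)
         (N : 'M[C]_k -> 'M[C]_k),
    [/\ (maxn m n <= k)%N, isometric_channel V, isometric_channel U,
        unital_channel N & U sigma = N (V rho)].

(* A real function on density operators of all dimensions is represented by a
   function on all square matrices; its values off the density operators are
   arbitrary and enter none of the conditions. *)
Record quantum_entropy (H : forall n, 'M[C]_n -> R) : Prop := QuantumEntropy {
  entropy_neq0 : exists n (rho : 'M[C]_n), density rho /\ H n rho <> 0;
  entropy_monotone : forall m n (rho : 'M[C]_m) (sigma : 'M[C]_n),
    density rho -> density sigma -> majorizes rho sigma ->
    H m rho <= H n sigma;
  entropy_additive : forall m n (rho : 'M[C]_m) (sigma : 'M[C]_n),
    density rho -> density sigma ->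
    H (m * n)%N (rho *t sigma) = H m rho + H n sigma
}.

End Operators.

(* Main.v *)
(* Isometries preserve H, and additivity on the one-dimensional state gives it
   entropy 0, hence so do all pure states. By the spectral theorem every state
   is a mixture of unitary images of one pure state in its own dimension, so
   H >= 0. Completely depolarizing after an isometric embedding shows
   H rho <= H (u_n) whenever dim rho <= n. If H (u_2) vanished, then by
   additivity so would H (u_(2^m)) for all m, and H would be zero. *)
Require Import Defs.
From HB Require Import structures.
From mathcomp Require Import all_boot all_order all_algebra.
From mathcomp Require Import perm reals complex mxtens.

Set Implicit Arguments.
Unset Strict Implicit.
Unset Printing Implicit Defensive.

Import Order.TTheory GRing.Theory Num.Theory.
Local Open Scope ring_scope.

(** * Adjoints of complex matrices *)

Section Adjoint.
Local Open Scope sesquilinear_scope.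
Variable C : numClosedFieldType.

Lemma adjmxM m n p (A : 'M[C]_(m, n)) (B : 'M[C]_(n, p)) :
  (A *m B)^t* = B^t* *m A^t*.
Proof. by rewrite trmx_mul map_mxM. Qed.

Lemma adjmx1 n : (1%:M : 'M[C]_n)^t* = 1%:M.
Proof. by rewrite trmx1 map_mx1. Qed.

Lemma adjmx_delta m n (i : 'I_m) (j : 'I_n) :
  (delta_mx i j : 'M[C]_(m, n))^t* = delta_mx j i.
Proof. by rewrite trmx_delta map_delta_mx. Qed.

Lemma adjmx_pid m n r : (pid_mx r : 'M[C]_(m, n))^t* = pid_mx r.
Proof. by rewrite tr_pid_mx map_pid_mx. Qed.

Lemma pid_mx_isometry m n : (m <= n)%N ->
  (pid_mx m : 'M[C]_(n, m))^t* *m (pid_mx m : 'M[C]_(n, m)) = 1%:M.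
Proof.
by move=> le_mn; rewrite adjmx_pid mul_pid_mx minnn (minn_idPr _) // pid_mx_1.
Qed.

Lemma mul_adjmx_ge0 n (v : 'cV[C]_n) : 0 <= (v^t* *m v) 0 0.
Proof.
rewrite mxE sumr_ge0 // => i _; rewrite !mxE mulrC; exact: mul_conjC_ge0.
Qed.

End Adjoint.

Section Operators.
Local Open Scope sesquilinear_scope.
Variable R : realType.
Local Notation C := R[i].

(** * Positive semidefinite operators and their spectral decomposition *)

Lemma density_dim_gt0 n (rho : 'M[C]_n) : density rho -> (0 < n)%N.
Proof.
case: n rho => [|//] rho [_]; rewrite /mxtrace big_ord0 => /esym/eqP.
by rewrite oner_eq0.
Qed.

Lemma psd_conj m n (W : 'M[C]_(n, m)) (A : 'M[C]_m) :
  psd A -> psd (W *m A *m W^t*).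
Proof.
move=> A_psd v; have := A_psd (W^t* *m v).
by rewrite adjmxM trmxCK !mulmxA.
Qed.

Lemma psd1 n : psd (1%:M : 'M[C]_n).
Proof. by move=> v; rewrite mulmx1 mul_adjmx_ge0. Qed.

Lemma psd_scale n (c : C) (A : 'M[C]_n) : 0 <= c -> psd A -> psd (c *: A).
Proof.
by move=> c_ge0 A_psd v; rewrite -scalemxAr -scalemxAl mxE mulr_ge0.
Qed.

Lemma psd_sum n (I : finType) (A : I -> 'M[C]_n) :
  (forall i, psd (A i)) -> psd (\sum_i A i).
Proof.
move=> A_psd v; rewrite mulmx_sumr mulmx_suml summxE.
by apply: sumr_ge0 => i _; apply: A_psd.
Qed.

(** Here [v] is a unit eigenvector for [d 0 i], so facts about a quadratic form pass to the
    eigenvalues. *)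
Lemma unitary_diag_form n (P : 'M[C]_n) (d : 'rV[C]_n) (i : 'I_n)
    (v : 'cV[C]_n := P^t* *m delta_mx i 0) :
  P \is unitarymx -> (v^t* *m (P^t* *m diag_mx d *m P) *m v) 0 0 = d 0 i.
Proof.
move=> P_unitary; rewrite adjmxM trmxCK adjmx_delta /v !mulmxA !mulmxtVK //.
by rewrite -rowE -colE !mxE eqxx mulr1n.
Qed.

(* A - A^t* is normal with vanishing quadratic form, so its eigenvalues are 0. *)
Lemma psd_adjmx n (A : 'M[C]_n) : psd A -> A^t* = A.
Proof.
move=> A_psd; set D := A - A^t*.
have DC : D^t* = - D.
  by rewrite /D linearB map_mxB trmxCK opprB.
have Dform (v : 'cV[C]_n) : (v^t* *m D *m v) 0 0 = 0.
  rewrite /D mulmxBr mulmxBl mxE [X in _ + X]mxE.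
  (* The form of [A^t*] is the conjugate of the form of [A], whose values are nonnegative and hence
     real; the two cancel. *)
  have -> : v^t* *m A^t* *m v = (v^t* *m A *m v)^t*.
    by rewrite !adjmxM trmxCK mulmxA.
  rewrite [in X in _ - X]mxE [in X in _ - X]mxE.
  by rewrite (CrealP (ger0_real (A_psd v))) subrr.
have Dnormal : D \is normalmx.
  by apply/normalmxP; rewrite DC mulmxN mulNmx.
have /orthomx_spectralP := Dnormal.
rewrite (invmx_unitary (spectral_unitarymx D)).
move: (spectralmx D) (spectral_diag D) (spectral_unitarymx D) => P d P_unitary D_eq.
suff d0 : d = 0.
  by apply/esym/eqP; rewrite -subr_eq0 -/D D_eq d0 linear0 mulmx0 mul0mx.
by apply/rowP => i; rewrite [RHS]mxE -(unitary_diag_form d i P_unitary) -D_eq Dform.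
Qed.

Lemma psd_spectral n (A : 'M[C]_n) : psd A ->
  exists (P : 'M[C]_n) (d : 'rV[C]_n),
    [/\ P \is unitarymx, forall i, 0 <= d 0 i & A = P^t* *m diag_mx d *m P].
Proof.
move=> A_psd; have AC := psd_adjmx A_psd.
have Anormal : A \is normalmx by apply/normalmxP; rewrite AC.
have /orthomx_spectralP := Anormal.
rewrite (invmx_unitary (spectral_unitarymx A)).
move: (spectralmx A) (spectral_diag A) (spectral_unitarymx A) => P d P_unitary A_eq.
exists P, d; split=> // i.
by rewrite -(unitary_diag_form d i P_unitary) -A_eq A_psd.
Qed.

(** * Channels in Kraus form *)

Definition weighted_kraus n (I : finType) (c : I -> C) (K : I -> 'M[C]_n)
  (X : 'M[C]_n) : 'M[C]_n := \sum_i c i *: (K i *m X *m (K i)^t*).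

Lemma mul_tens1mx k m n p (K : 'M[C]_(n, m)) (Y : 'M[C]_(k * m, p)) i a t :
  ((1%:M *t K) *m Y) (mxtens_index (i, a)) t =
  \sum_d K a d * Y (mxtens_index (i, d)) t.
Proof.
transitivity (\sum_j \sum_d (1%:M *t K) (mxtens_index (i, a))
    (mxtens_index (j, d)) * Y (mxtens_index (j, d)) t).
  rewrite mxE pair_bigA (reindex (@mxtens_index k m)) /=; last first.
    by exists (@mxtens_unindex k m) => s _; rewrite (mxtens_indexK, mxtens_unindexK).
  by apply: eq_bigr => -[].
rewrite (bigD1 i) //= [X in _ + X]big1 ?addr0 => [|j /negPf ne_ji].
  by apply: eq_bigr => d _; rewrite tensmxE mxE eqxx mul1r.
by apply: big1 => d _; rewrite tensmxE mxE eq_sym ne_ji !mul0r.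
Qed.

Lemma mul_adjmx_tens1mx k m n p (K : 'M[C]_(n, m)) (Y : 'M[C]_(p, k * m)) s j b :
  (Y *m (1%:M *t K)^t*) s (mxtens_index (j, b)) =
  \sum_d Y s (mxtens_index (j, d)) * (K b d)^*.
Proof.
rewrite -[Y]trmxCK -adjmxM [LHS]mxE [in LHS]mxE mul_tens1mx rmorph_sum.
by apply: eq_bigr => d _; rewrite rmorphM /= mulrC !mxE.
Qed.

(** Reduces complete positivity of a conjugation to [psd_conj]: its extension is again a
    conjugation. *)
Lemma id_tens_conj k m n (K : 'M[C]_(n, m)) (X : 'M[C]_(k * m)) :
  id_tens (fun Y => K *m Y *m K^t*) X = (1%:M *t K) *m X *m (1%:M *t K)^t*.
Proof.
apply/matrixP => s t; case: (mxtens_indexP s) => i a.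
case: (mxtens_indexP t) => j b.
rewrite mul_adjmx_tens1mx mxE !mxtens_indexK /= mxE.
apply: eq_bigr => d _; rewrite mul_tens1mx !mxE; congr (_ * _).
by apply: eq_bigr => e _; rewrite mxE.
Qed.

Lemma id_tens_weighted_kraus k n (I : finType) (c : I -> C) (K : I -> 'M[C]_n)
    (X : 'M[C]_(k * n)) :
  id_tens (weighted_kraus c K) X =
  \sum_i c i *: ((1%:M *t K i) *m X *m (1%:M *t K i)^t*).
Proof.
apply/matrixP => s t; rewrite mxE !summxE; apply: eq_bigr => i _.
by rewrite -id_tens_conj [in RHS]mxE [in RHS]mxE mxE.
Qed.

(** Nonnegative weights give complete positivity, the first sum gives trace preservation by
    cyclicity of the trace, the second gives unitality. Weights outside the Kraus operators avoid
    square roots of probabilities. *)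
Lemma weighted_kraus_unital n (I : finType) (c : I -> C) (K : I -> 'M[C]_n) :
  (forall i, 0 <= c i) ->
  \sum_i c i *: ((K i)^t* *m K i) = 1%:M ->
  \sum_i c i *: (K i *m (K i)^t*) = 1%:M ->
  unital_channel (weighted_kraus c K).
Proof.
move=> c_ge0 KK1 KK2; split; last first.
  by rewrite /weighted_kraus -[RHS]KK2; apply: eq_bigr => i _; rewrite mulmx1.
split=> [a X Y|k X X_psd|X].
- rewrite /weighted_kraus scaler_sumr -big_split /=; apply: eq_bigr => i _.
  rewrite mulmxDr mulmxDl scalerDr; congr (_ + _).
  by rewrite -scalemxAr -scalemxAl !scalerA mulrC.
- rewrite id_tens_weighted_kraus; apply: psd_sum => i.
  by apply: psd_scale => //; apply: psd_conj.
- rewrite raddf_sum /= -[in RHS](mul1mx X) -KK1 mulmx_suml raddf_sum /=.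
  apply: eq_bigr => i _.
  by rewrite -scalemxAl !mxtraceZ mxtrace_mulC mulmxA.
Qed.

Lemma random_unitary_unital n (I : finType) (p : I -> C) (U : I -> 'M[C]_n) :
  (forall i, 0 <= p i) -> \sum_i p i = 1 -> (forall i, U i \is unitarymx) ->
  unital_channel (weighted_kraus p U).
Proof.
move=> p_ge0 p1 U_unitary; apply: weighted_kraus_unital => //.
  rewrite -[RHS]scale1r -[X in _ = X *: _]p1 scaler_suml; apply: eq_bigr => i _.
  by move: (U_unitary i); rewrite -trmxC_unitary => /unitarymxP; rewrite trmxCK => ->.
rewrite -[RHS]scale1r -[X in _ = X *: _]p1 scaler_suml; apply: eq_bigr => i _.
by rewrite (unitarymxP (U_unitary i)).
Qed.

Lemma id_unital n : unital_channel (@id 'M[C]_n).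
Proof.
split=> //; split=> // k X.
suff -> : id_tens id X = X by [].
by apply/matrixP => s t; rewrite !mxE !mxtens_unindexK.
Qed.

Definition depolarizing n : 'M[C]_n -> 'M[C]_n :=
  weighted_kraus (fun=> n%:R^-1) (fun ij : 'I_n * 'I_n => delta_mx ij.1 ij.2).

(** With matrix units E_ij as Kraus operators, E_ij X E_ji = X_jj E_ii; summing over j yields the
    trace, and over i the identity. *)
Lemma depolarizingE n (X : 'M[C]_n) :
  depolarizing X = \tr X *: uniform_state R n.
Proof.
rewrite /depolarizing /weighted_kraus -scaler_sumr.
rewrite -(pair_bigA _ (fun i j => delta_mx i j *m X *m (delta_mx i j)^t*)) /=.
rewrite /uniform_state -scalemx1 scalerA mulrC -scalerA.
congr (_ *: _); rewrite -diag_const_mx diag_mx_sum_delta scaler_sumr.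
apply: eq_bigr => i _; rewrite /mxtrace mxE scale1r scaler_suml.
apply: eq_bigr => j _; rewrite adjmx_delta.
apply/matrixP => a b; rewrite mxE [RHS]mxE (bigD1 j) //= big1 => [|l ne_lj].
  rewrite addr0 [X in X * _]mxE (bigD1 j) //= big1 => [|l /negPf ne_lj].
    rewrite addr0 !mxE !eqxx !andbT; case: (a == i); case: (b == i) => //=;
    by rewrite ?mulr1 ?mul1r ?mulr0 ?mul0r.
  by rewrite mxE ne_lj andbF mul0r.
by rewrite [X in _ * X]mxE (negPf ne_lj) mulr0.
Qed.

Lemma depolarizing_unital n : (0 < n)%N -> unital_channel (@depolarizing n).
Proof.
move=> n_gt0; have nN0 : n%:R != 0 :> C by rewrite pnatr_eq0 -lt0n.
(* Serves both normalisations: each E_ii occurs n times, which the weight 1/n cancels. *)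
have sum_delta (F : 'I_n * 'I_n -> 'M[C]_n) :
    (forall ij, F ij = delta_mx ij.1 ij.1) -> \sum_ij n%:R^-1 *: F ij = 1%:M.
  move=> FE; rewrite -scaler_sumr (eq_bigr _ (fun ij _ => FE ij)).
  rewrite -(pair_bigA _ (fun i _ => delta_mx i i)) /=.
  rewrite -diag_const_mx diag_mx_sum_delta scaler_sumr.
  apply: eq_bigr => i _; rewrite mxE scale1r.
  by rewrite sumr_const card_ord -scalerMnr scalerMnl
    -[_^-1 *+ n]mulr_natr mulVf // scale1r.
apply: weighted_kraus_unital => [_||].
- by rewrite invr_ge0 ler0n.
(* The adjoint of E_ij times E_ij is E_jj, so the two indices are swapped first. *)
- rewrite (reindex_inj (h := fun ij : 'I_n * 'I_n => (ij.2, ij.1))) /=; last first.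
    by move=> [a b] [c d] [-> ->].
  apply: (sum_delta (fun ij => _)) => ij.
  by rewrite adjmx_delta mul_delta_mx.
- by apply: (sum_delta (fun ij => _)) => ij; rewrite adjmx_delta mul_delta_mx.
Qed.

(** * Isometries, uniform states and pure states *)

Lemma isometric_conj m n (W : 'M[C]_(n, m)) : W^t* *m W = 1%:M ->
  isometric_channel (fun X => W *m X *m W^t*).
Proof. by move=> WW; exists W. Qed.

Lemma isometric_id n : isometric_channel (@id 'M[C]_n).
Proof.
by exists 1%:M => [|X]; rewrite adjmx1 ?mulmx1 // mul1mx.
Qed.

Lemma density_conj m n (W : 'M[C]_(n, m)) (rho : 'M[C]_m) :
  W^t* *m W = 1%:M -> density rho -> density (W *m rho *m W^t*).
Proof.
move=> WW [rho_psd rho1]; split; first exact: psd_conj.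
by rewrite mxtrace_mulC mulmxA WW mul1mx.
Qed.

Lemma density_uniform n : (0 < n)%N -> density (uniform_state R n).
Proof.
move=> n_gt0; split.
  rewrite /uniform_state -scalemx1; apply: psd_scale; last exact: psd1.
  by rewrite invr_ge0 ler0n.
by rewrite mxtrace_scalar -[_^-1 *+ n]mulr_natr mulVf // pnatr_eq0 -lt0n.
Qed.

Lemma uniform_tens m n :
  uniform_state R m *t uniform_state R n = uniform_state R (m * n).
Proof.
apply/matrixP => s t; case: (mxtens_indexP s) => i a.
case: (mxtens_indexP t) => j b.
rewrite tensmxE !mxE (can_eq (@mxtens_indexK m n)) xpair_eqE natrM invfM.
by case: (i == j); case: (a == b); rewrite ?mulr0 ?mul0r.
Qed.

(** A unit vector is an isometry from C^1, so a pure state is an isometric image of the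
    one-dimensional state. *)
Lemma pure_stateE n (psi : 'cV[C]_n) :
  pure_state psi = psi *m uniform_state R 1 *m psi^t*.
Proof. by rewrite /uniform_state invr1 mulmx1. Qed.

Lemma density_pure n (psi : 'cV[C]_n) : unit_vector psi -> density (pure_state psi).
Proof.
by move=> psi1; rewrite pure_stateE; apply: density_conj => //; apply: density_uniform.
Qed.

(** * Majorization relations *)

Lemma majorizes_conj m n (W : 'M[C]_(n, m)) (rho : 'M[C]_m) :
  W^t* *m W = 1%:M ->
  majorizes rho (W *m rho *m W^t*) /\ majorizes (W *m rho *m W^t*) rho.
Proof.
move=> WW; have le_mn : (m <= n)%N := mulmx1_min WW.
have [[isoW iso1] un1] := (isometric_conj WW, @isometric_id n, @id_unital n).
split; exists n.
  by exists (fun X => W *m X *m W^t*), id, id; split; rewrite // geq_max le_mn /=.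
by exists id, (fun X => W *m X *m W^t*), id; split; rewrite // geq_max le_mn /= andbT.
Qed.

Lemma majorizes_uniform m n (rho : 'M[C]_m) : (m <= n)%N -> density rho ->
  majorizes rho (uniform_state R n).
Proof.
move=> le_mn rho_density.
have n_gt0 : (0 < n)%N by apply: leq_trans le_mn; apply: density_dim_gt0 rho_density.
have WW := pid_mx_isometry C le_mn.
set W := (pid_mx m : 'M[C]_(n, m)) in WW.
exists n, (fun X => W *m X *m W^t*), id, (@depolarizing n); split.
- by rewrite geq_max le_mn /=.
- exact: isometric_conj.
- exact: isometric_id.
- exact: depolarizing_unital.
- by rewrite depolarizingE (density_conj WW rho_density).2 scale1r.
Qed.

(* In an eigenbasis of rho, move one basis vector to the i-th one with
   probability the i-th eigenvalue. *)
Lemma majorized_by_pure n (rho : 'M[C]_n) : density rho ->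
  exists2 psi : 'cV[C]_n, unit_vector psi & majorizes (pure_state psi) rho.
Proof.
move=> rho_density; have n_gt0 := density_dim_gt0 rho_density.
have [rho_psd rho1] := rho_density.
have [P [d [P_unitary d_ge0 rhoE]]] := psd_spectral rho_psd.
have PP := unitarymxP P_unitary.
pose i0 := Ordinal n_gt0.
pose psi : 'cV[C]_n := P^t* *m delta_mx i0 0.
(* Swaps the eigenvectors numbered [i0] and [i], hence sends [psi] to the latter. *)
pose U i : 'M[C]_n := P^t* *m tperm_mx i0 i *m P.
exists psi.
  rewrite /unit_vector adjmxM trmxCK adjmx_delta mulmxA mulmxtVK // mul_delta_mx.
  by apply/matrixP => a b; rewrite !ord1 !mxE !eqxx.
have d1 : \sum_i d 0 i = 1.
  by rewrite -rho1 rhoE mxtrace_mulC mulmxA PP mul1mx mxtrace_diag.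
have U_unitary i : U i \is unitarymx.
  rewrite !mul_unitarymx ?trmxC_unitary //.
  by apply/unitarymxP; rewrite tr_perm_mx map_perm_mx -perm_mxM mulgV perm_mx1.
exists n, id, id, (weighted_kraus (d 0) U); split.
- by rewrite maxnn.
- exact: isometric_id.
- exact: isometric_id.
- exact: random_unitary_unital.
have Upsi i : U i *m psi = P^t* *m delta_mx i 0.
  rewrite /U /psi mulmxA mulmxtVK // -mulmxA; congr (_ *m _).
  by rewrite -colE; apply/matrixP => a b; rewrite !mxE !ord1 eqxx andbT
    (canF_eq (tpermK i0 i)) tpermL.
(* The image of the pure state is the spectral decomposition of [rho], compared term by term. *)
rewrite /weighted_kraus rhoE diag_mx_sum_delta mulmx_sumr mulmx_suml.
apply: eq_bigr => i _; rewrite -scalemxAr -scalemxAl; congr (_ *: _).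
rewrite /pure_state mulmxA Upsi -mulmxA -adjmxM Upsi adjmxM trmxCK adjmx_delta.
by rewrite mulmxA -[_ *m delta_mx i 0 *m _]mulmxA mul_delta_mx.
Qed.

(** * Values of an entropy *)

Variable H : forall n, 'M[C]_n -> R.
Hypothesis entH : quantum_entropy H.

Lemma entropy_conj m n (W : 'M[C]_(n, m)) (rho : 'M[C]_m) :
  W^t* *m W = 1%:M -> density rho -> H (W *m rho *m W^t*) = H rho.
Proof.
move=> WW rho_density; have Wrho_density := density_conj WW rho_density.
have [rhoW Wrho] := majorizes_conj rho WW.
by apply/eqP; rewrite eq_le !(entropy_monotone entH).
Qed.

Lemma entropy_uniform1 : H (uniform_state R 1) = 0.
Proof.
have u1 := @density_uniform 1 isT.
(* The dimension [1 * 1] computes to 1, so the entropy h of this state satisfies h = h + h. *)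
have := entropy_additive entH u1 u1; rewrite uniform_tens => /eqP.
by rewrite -subr_eq0 opprD addrA subrr sub0r oppr_eq0 => /eqP.
Qed.

Lemma entropy_pure n (psi : 'cV[C]_n) : unit_vector psi -> H (pure_state psi) = 0.
Proof.
move=> psi1; rewrite pure_stateE entropy_conj ?entropy_uniform1 //.
exact: density_uniform.
Qed.

Lemma entropy_ge0 n (rho : 'M[C]_n) : density rho -> 0 <= H rho.
Proof.
move=> rho_density; have [psi psi1 psi_rho] := majorized_by_pure rho_density.
rewrite -(entropy_pure psi1); apply: (entropy_monotone entH) => //.
exact: density_pure.
Qed.

(** Allowing m < n makes it possible to compare a state of any dimension with a uniform state in
    dimension a power of 2. *)
Lemma entropy_le_uniform m n (rho : 'M[C]_m) : (m <= n)%N -> density rho ->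
  H rho <= H (uniform_state R n).
Proof.
move=> le_mn rho_density; apply: (entropy_monotone entH) => //.
  by apply: density_uniform; apply: leq_trans le_mn; apply: density_dim_gt0 rho_density.
exact: majorizes_uniform.
Qed.

Lemma entropy_uniform_exp2 m :
  H (uniform_state R (2 ^ m)) = H (uniform_state R 2) *+ m.
Proof.
elim: m => [|m IHm]; first by rewrite expn0 entropy_uniform1.
rewrite expnS -uniform_tens (entropy_additive entH) ?IHm ?mulrS //;
by apply: density_uniform; rewrite ?expn_gt0.
Qed.

Lemma entropy_uniform2_gt0 : 0 < H (uniform_state R 2).
Proof.
rewrite lt_neqAle entropy_ge0 ?andbT; last exact: density_uniform.
apply/eqP => u2; have [n [rho [rho_density]]] := entropy_neq0 entH; apply.
apply/eqP; rewrite eq_le entropy_ge0 // andbT.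
(* Since n < 2^n, the entropy of [rho] is at most n times that of the uniform qubit state, assumed
   to be 0. *)
have := entropy_le_uniform (ltnW (ltn_expl n (ltnSn 1))) rho_density.
by rewrite entropy_uniform_exp2 -u2 mul0rn.
Qed.

End Operators.

Theorem mainTheorem5 (R : realType) (H : forall n : nat, 'M[R[i]]_n -> R)
    (entH : quantum_entropy H) :
  [/\ (forall (n : nat) (rho : 'M[R[i]]_n), density rho -> 0 <= H n rho),
      (forall (n : nat) (psi : 'cV[R[i]]_n),
         unit_vector psi -> H n (pure_state psi) = 0),
      (forall (d : nat) (sigma : 'M[R[i]]_d),
         density sigma -> H d sigma <= H d (uniform_state R d)) &
      0 < H 2%N (uniform_state R 2)].
Proof.
split=> [n rho|n psi|d sigma|].
- exact: entropy_ge0.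
- exact: entropy_pure.
- exact: entropy_le_uniform.
- exact: entropy_uniform2_gt0.
Qed.
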